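(* Let $k$ be an algebraically closed field of characteristic $p>0$. Every smooth extremal surface $X\subset\mathbb P^3_k$ of degree $d$ contains double $2d$ configurations of lines; that is, there exists a double $2d$ all of whose lines lie on $X$.
   Context: $k$ is an algebraically closed field of characteristic $p>0$. A Frobenius form in variables $x_1,\dots,x_n$ is a homogeneous polynomial of degree $q+1$, where $q=p^e$ for some $e\ge 1$, of the form $\sum_{i=1}^n x_i^{q}L_i$ with each $L_i$ a linear form. An extremal surface of degree $d=q+1$ is a surface in $\mathbb P^3_k$ defined by a Frobenius form of degree $d$ in four variables. For $d\ge 2$, a double $2d$ is a collection of two sets $\mathcal A$ and $\mathcal B$, each consisting of $2d$ lines in $\mathbb P^3_k$, such that (1) each line in $\mathcal A$ (resp. $\mathcal B$) is skew to every other line in $\mathcal A$ (resp. $\mathcal B$); and (2) each line in $\mathcal A$ (resp. $\mathcal B$) intersects exactly $d+2$ lines in $\mathcal B$ (resp. $\mathcal A$). *)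

(* Defs.v *)
From HB Require Import structures.
From mathcomp Require Import all_boot all_order all_algebra.
From mathcomp Require Import finmap.
From mathcomp Require Import mpoly.

Set Implicit Arguments.
Unset Strict Implicit.
Unset Printing Implicit Defensive.

Import GRing.Theory.
Local Open Scope fset_scope.
Local Open Scope ring_scope.

Definition frobenius_sum (k : fieldType) (n q : nat) (F : {mpoly k[n]}) : Prop :=
  exists2 L : 'I_n -> {mpoly k[n]},
    forall i, L i \is 1.-homog & F = \sum_(i < n) 'X_i ^+ q * L i.

Definition frobenius_form (k : fieldType) (p n d : nat) (F : {mpoly k[n]})
    : Prop :=
  exists e : nat, [/\ (0 < e)%N, d = (p ^ e).+1 & frobenius_sum (p ^ e) F].

(* Points of P^(n-1)(k) are represented by nonzero row vectors, so [F] is a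
   homogeneous equation and [vanishes F u] only depends on the line [k u]. *)
Definition vanishes (k : fieldType) (n : nat) (F : {mpoly k[n]})
    (u : 'rV[k]_n) : Prop :=
  F.@[u ord0] = 0.

(* Jacobian criterion for the projective hypersurface [F = 0]; it forces
   [F != 0] when [0 < n]. The vanishing of [F] itself is kept as a hypothesis:
   Euler's formula does not make it redundant when the characteristic divides
   the degree. Over an algebraically closed field it suffices to test
   [k]-rational points. *)
Definition smooth_hypersurface (k : fieldType) (n : nat) (F : {mpoly k[n]})
    : Prop :=
  forall u : 'rV[k]_n, u != 0 -> vanishes F u ->
    exists i : 'I_n, ~ vanishes F^`M(i) u.

(* A line of P^3 is a 2-dimensional linear subspace of k^4. Two lines meet
   when they share a projective point (so a line meets itself), that is, when
   the subspaces share a nonzero vector. *)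
Definition is_line (k : fieldType) (l : {vspace 'rV[k]_4}) : bool :=
  \dim l == 2%N.

Definition meet (k : fieldType) (l m : {vspace 'rV[k]_4}) : bool :=
  (l :&: m != 0)%VS.

Definition line_on (k : fieldType) (F : {mpoly k[4]})
    (l : {vspace 'rV[k]_4}) : Prop :=
  forall u : 'rV[k]_4, u \in l -> vanishes F u.

Definition pairwise_skew (k : fieldType) (A : {fset {vspace 'rV[k]_4}})
    : Prop :=
  {in A &, forall l m, l != m -> ~~ meet l m}.

Definition meets_exactly (k : fieldType) (c : nat)
    (A B : {fset {vspace 'rV[k]_4}}) : Prop :=
  {in A, forall l, #|` [fset m in B | meet l m]| = c}.

Record double_2d (k : fieldType) (d : nat) (A B : {fset {vspace 'rV[k]_4}})
    : Prop := Double2d {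
  double_lineA : {in A, forall l, is_line l};
  double_lineB : {in B, forall l, is_line l};
  double_cardA : #|` A| = (2 * d)%N;
  double_cardB : #|` B| = (2 * d)%N;
  double_skewA : pairwise_skew A;
  double_skewB : pairwise_skew B;
  double_meetAB : meets_exactly (d + 2) A B;
  double_meetBA : meets_exactly (d + 2) B A
}.

(* Main.v *)
(* Write [F(u) = u^[q] A u^T], where [u^[q]] raises the coordinates of [u] to the
   power [q]. The gradient of [F] is [u^[q] A], so smoothness makes [A]
   invertible. Lang's theorem for [GL_n] and the Frobenius of [F_(q^2)] gives a
   basis in which [A] is Hermitian over [F_(q^2)], and a Hermitian form has an
   orthonormal basis; hence [X] is projectively the Fermat surface.

   Fix [w <> 1] with [w^d = 1], and let [a] run over the roots of [a^d = -1]. For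
   [eps] in [{1, w}] the Fermat surface contains the lines
   [L(eps, a) = {(x, y, a x, eps a y)}] and
   [L'(eps, a) = {(x, a x, y, eps a y)}]. Lines [L(eps, a)] and [L(eps', b)] meet
   iff [a = b] or [eps a = eps' b], and likewise for [L'], while [L(eps, a)] and
   [L'(eps', b)] meet iff [eps = eps']. The double [2d] consists of
   [L(1, _), L'(w, _)] on one side and [L(w, _), L'(1, _)] on the other: each line
   meets all [d] lines of the other side in the opposite ruling and exactly two in
   its own. *)

Require Import Defs.
From HB Require Import structures.
From mathcomp Require Import all_boot all_order all_algebra.
From mathcomp Require Import finmap.
From mathcomp Require Import separable.
From mathcomp Require Import mpoly ring.

Set Implicit Arguments.
Unset Strict Implicit.
Unset Printing Implicit Defensive.

Import GRing.Theory.
Local Open Scope ring_scope.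

(** * Frobenius powers and roots over an algebraically closed field *)

(** The argument [hp] makes the ring morphism structure attachable to [frob hp e]. *)
Definition frob (k : fieldType) (p : nat) (hp : p \in [pchar k]) (e : nat)
  (x : k) : k := x ^+ (p ^ e).

Section FrobeniusMorphism.

Variables (k : fieldType) (p : nat) (hp : p \in [pchar k]) (e : nat).

Lemma frob_is_zmod_morphism : zmod_morphism (frob hp e).
Proof.
have q_nat : [pchar k].-nat (p ^ e)%N.
  by rewrite pnatX pnatE ?(pcharf_prime hp) // hp.
by move=> x y; rewrite /frob exprDn_pchar // exprNn_pchar.
Qed.

Lemma frob_is_monoid_morphism : monoid_morphism (frob hp e).
Proof. by split=> [|x y]; rewrite /frob ?expr1n ?exprMn. Qed.

HB.instance Definition _ :=
  GRing.isZmodMorphism.Build k k (frob hp e) frob_is_zmod_morphism.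
HB.instance Definition _ :=
  GRing.isMonoidMorphism.Build k k (frob hp e) frob_is_monoid_morphism.

Lemma frob_frob e' x : frob hp e' (frob hp e x) = frob hp (e + e') x.
Proof. by rewrite /frob -exprM expnD. Qed.

Lemma expq_gt1 : (0 < e)%N -> (1 < p ^ e)%N.
Proof.
by move=> e_gt0; rewrite -(exp1n e) ltn_exp2r // prime_gt1 ?(pcharf_prime hp).
Qed.

End FrobeniusMorphism.

Section Roots.

Variables (k : closedFieldType) (p : nat) (hp : p \in [pchar k]) (e : nat).

Lemma exists_nth_root n (x : k) : (0 < n)%N -> exists y, y ^+ n = x.
Proof.
move=> n_gt0; have /closed_rootP[y] : size ('X^n - x%:P) != 1.
  by rewrite size_XnsubC // eqSS -lt0n.
by rewrite rootE !hornerE subr_eq0 => /eqP <-; exists y.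
Qed.

(** A root of [x T^q - T + y], which has degree [q], or 1 when [x = 0]. *)
Lemma frob_affine_fixpoint (x y : k) :
  (0 < e)%N -> exists t, t = frob hp e t * x + y.
Proof.
move=> /(expq_gt1 hp) q_gt1.
have /closed_rootP[t] : size (x *: 'X^(p ^ e) - ('X - y%:P)) != 1.
  have [-> | x0] := eqVneq x 0.
    by rewrite scale0r sub0r size_polyN size_XsubC.
  rewrite size_polyDl size_scale ?size_polyXn ?size_polyN ?size_XsubC //.
  by rewrite eqSS -lt0n ltnW.
rewrite rootE !hornerE subr_eq0 => /eqP h; exists t.
by rewrite /frob mulrC h subrK.
Qed.

End Roots.

(** * Fixed vectors of semilinear maps *)

(* Writing [Phi] for a [q]-semilinear map with [Phi^(m+1) v] equal to the sum of
   the [a_i Phi^i v], the vector with coordinates [c_i] on the [Phi^i v] is fixed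
   by [Phi] iff [c_0 = a_0 t^q], [c_(i+1) = c_i^q + a_(i+1) t^q] and [c_m = t]. *)
Fixpoint cyclic_coord (k : fieldType) (q : nat) (a : nat -> k) (i : nat) :
    {poly k} :=
  (if i is j.+1 then cyclic_coord q a j ^+ q else 0) + a i *: 'X^q.

(** Once the degree reaches [q], the next [q]-th power has degree at least [q^2 > q], so the added
    multiple of [X^q] cannot cancel it. *)
Lemma cyclic_coord_dichotomy (k : fieldType) (q : nat) (a : nat -> k) i :
  (1 < q)%N ->
  (cyclic_coord q a i = 0 /\ forall j, (j <= i)%N -> a j = 0)
  \/ (q < size (cyclic_coord q a i))%N.
Proof.
move=> q_gt1; have q_gt0 := ltnW q_gt1.
elim: i => [|i [[ci0 a0]|szi]] /=.
- rewrite add0r; have [a00|a00] := eqVneq (a 0%N) 0.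
    by left; split; [rewrite a00 scale0r | case].
  by right; rewrite size_scale // size_polyXn.
- rewrite ci0 expr0n gtn_eqF // add0r; have [ai0|ai0] := eqVneq (a i.+1) 0.
    left; split; first by rewrite ai0 scale0r.
    by move=> j; rewrite leq_eqVlt => /predU1P[->|/a0].
  by right; rewrite size_scale // size_polyXn.
right; set c := cyclic_coord q a i in szi *.
have sz_aX : (size (a i.+1 *: 'X^q : {poly k}) <= q.+1)%N.
  by rewrite (leq_trans (size_scale_leq _ _)) ?size_polyXn.
have sz_c : (q.+1 < size (c ^+ q))%N.
  rewrite -ltn_predRL size_exp; apply: leq_trans (_ : q * q <= _)%N.
    by rewrite ltn_Pmull.
  by rewrite leq_mul2r -ltnS prednK ?szi ?orbT // (leq_ltn_trans _ szi).
by rewrite size_polyDl ?(leq_ltn_trans sz_aX) // ltnW.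
Qed.

(** The polynomial is [r X^q], so its nonzero fixed points are the roots of the nonconstant
    polynomial [r X^(q-1) - 1]. *)
Lemma cyclic_coord_fixpoint (k : closedFieldType) (q : nat) (a : nat -> k) m :
  (1 < q)%N -> (exists2 j, (j <= m)%N & a j != 0) ->
  exists2 t, t != 0 & (cyclic_coord q a m).[t] = t.
Proof.
move=> q_gt1 [j le_jm aj0].
have [[_ /(_ j le_jm)/eqP]|] := cyclic_coord_dichotomy a m q_gt1.
  by rewrite (negPf aj0).
have [r ->]: exists r, cyclic_coord q a m = r * 'X^q.
  elim: m {le_jm} => [|m [r IH]] /=.
    by exists (a 0%N)%:P; rewrite add0r mul_polyC.
  exists (r ^+ q * 'X^(q * q.-1) + (a m.+1)%:P).
  rewrite mulrDl mul_polyC IH exprMn -!exprM -mulrA -exprD -mulnSr prednK //.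
  exact: ltnW.
move=> sz_rX; have r0 : r != 0.
  by apply: contraTneq sz_rX => ->; rewrite mul0r size_poly0.
have q1 : (0 < q.-1)%N by rewrite -ltnS prednK // ltnW.
have sz_r : (1 < size (r * 'X^(q.-1))%R)%N.
  by rewrite size_mulXn // -[2%N]addn1 leq_add // size_poly_gt0.
have /closed_rootP[t] : size (r * 'X^(q.-1) - 1) != 1.
  by rewrite size_polyDl ?size_polyN ?size_poly1 // gtn_eqF.
rewrite rootE !hornerE subr_eq0 => /eqP rt; exists t.
  apply/eqP => t0; move/eqP: rt.
  by rewrite t0 expr0n gtn_eqF // mulr0 eq_sym oner_eq0.
by rewrite !hornerE -[q]prednK ?exprSr ?mulrA ?rt ?mul1r // ltnW.
Qed.

(** The first linear relation among the iterates of [v] reduces the problem to a nonzero fixed point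
    of the last [cyclic_coord]. The trivial kernel keeps the iterates nonzero, so some coefficient
    of the relation is nonzero. *)
Lemma semilinear_fixed_vector (k : closedFieldType) (p : nat)
    (hp : p \in [pchar k]) (e : nat) (V : vectType k)
    (Phi : {additive V -> V}) (v : V) :
  (0 < e)%N -> (forall a u, Phi (a *: u) = frob hp e a *: Phi u) ->
  (forall u, Phi u = 0 -> u = 0) -> v != 0 ->
  exists2 u, u != 0 & Phi u = u.
Proof.
move=> /(expq_gt1 hp); set q := (p ^ e)%N => q_gt1 PhiZ Phi_inj v0.
pose w i := iter i Phi v; pose S m := (\sum_(i < m) <[w i]>)%VS.
have w0 i : w i != 0.
  by elim: i => //= i; apply: contra_neq => /Phi_inj.
have memS m u : u \in S m -> exists a : nat -> k, u = \sum_(i < m) a i *: w i.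
  case/memv_sumP => us us_w ->.
  have /fin_all_exists[a us_a] (i : 'I_m) : exists a, us i = a *: w i.
    by apply/vlineP/us_w.
  exists (fun i => if insub i is Some j then a j else 0).
  by apply: eq_bigr => i _; rewrite valK.
(* Otherwise each iterate enlarges the span, whose dimension would exceed that of [V] after [N]
   steps. *)
have ex_m : exists m, w m \in S m.
  pose N := (\dim {:V}).+1.
  have [/existsP[m wm]|/existsPn no_m] := boolP [exists m : 'I_N, w m \in S m].
    by exists m.
  suff dimS m : (m <= N)%N -> (m <= \dim (S m))%N.
    by have := dimS N (leqnn _); rewrite leqNgt ltnS dimvS // subvf.
  elim: m => // m IHm lt_mN; apply: leq_ltn_trans (IHm (ltnW lt_mN)) _.
  rewrite ltn_neqAle dimvS ?andbT; last by rewrite /S big_ord_recr addvSl.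
  apply: contra (no_m (Ordinal lt_mN)) => /=.
  rewrite dimv_leqif_eq; last by rewrite /S big_ord_recr addvSl.
  by rewrite /S big_ord_recr => /eqP ->; rewrite memvE addvSr.
case: (ex_minnP ex_m) => -[|m].
  by rewrite /S big_ord0 memv0 (negPf (w0 0%N)).
case/memS=> a w_rel min_m.
have [t t0 ct] : exists2 t, t != 0 & (cyclic_coord q a m).[t] = t.
  apply: cyclic_coord_fixpoint => //.
  have [/existsP[j aj0]|/existsPn a0] := boolP [exists j : 'I_m.+1, a j != 0].
    by exists j; rewrite // -ltnS.
  have /eqP[] := w0 m.+1; rewrite w_rel big1 // => i _.
  by move: (a0 i) => /negPn/eqP ->; rewrite scale0r.
pose c i := (cyclic_coord q a i).[t]; have cm : c m = t by [].
(* If this sum vanished, its nonzero last coefficient [t] would put [w m] in [S m], against the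
   minimality of [m.+1]. *)
exists (\sum_(i < m.+1) c i *: w i).
  rewrite big_ord_recr /= cm; apply: contraNneq t0 => /eqP.
  rewrite addrC addr_eq0 => /eqP tw; apply: contraTT (ltnSn m) => t0.
  rewrite -leqNgt; apply: min_m.
  rewrite -[w m](scalerK t0) tw scalerN -scaleNr memvZ // memv_suml // => i _.
  by apply: subvP (sumv_sup i _ _) _ _ => //; apply: memvZ; rewrite memv_line.
have PhiS i : Phi (c i *: w i) = c i ^+ q *: w i.+1 by rewrite PhiZ.
rewrite raddf_sum; under eq_bigr do rewrite PhiS.
rewrite big_ord_recr [X in X + _ = _]/= [w ord_max.+1]w_rel cm scaler_sumr.
rewrite [X in _ + X]big_ord_recl [RHS]big_ord_recl /= addrCA -big_split /=.
congr (_ + _); first by rewrite /c /= !hornerE scalerA mulrC.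
apply: eq_bigr => i _.
by rewrite scalerA -scalerDl /c /= !hornerE [_ * a _]mulrC.
Qed.

(** * Lang's theorem for matrices and Hermitian forms *)

Section MatrixLang.

Variables (k : closedFieldType) (p : nat) (hp : p \in [pchar k]).

Local Notation fr e := (map_mx (frob hp e)).

Lemma map_frob_frob m n e e' (A : 'M[k]_(m, n)) :
  fr e' (fr e A) = fr (e + e') A.
Proof. by apply/matrixP => i j; rewrite !mxE frob_frob. Qed.

(** In the rank decomposition of [v] the left factor is a scalar [c], so [v] is [c] times the first
    row of [row_ebase v]. *)
Lemma unitmx_usubmx n (v : 'rV[k]_(1 + n)) :
  v != 0 -> exists2 G : 'M[k]_(1 + n), G \in unitmx & usubmx G = v.
Proof.
move=> v0; have rv : \rank v = 1%N by apply/eqP; rewrite rank_rV v0.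
pose c := col_ebase v 0 0.
have def_c : col_ebase v = c%:M by rewrite [LHS]mx11_scalar.
have c0 : c != 0.
  by have := col_ebase_unit v; rewrite def_c unitmxE det_scalar1 unitfE.
exists (c *: row_ebase v).
  by rewrite unitmxE detZ unitrM -unitmxE row_ebase_unit andbT unitfE expf_neq0.
rewrite -[RHS]mulmx_ebase rv def_c mul_scalar_mx -scalemxAl.
rewrite pid_mx_row -[in RHS](vsubmxK (row_ebase v)).
rewrite mul_row_col mul1mx mul0mx addr0.
by apply/matrixP => i j; rewrite !mxE.
Qed.

(* A fixed row reduces [C] to a block triangular matrix with upper left block [1];
   the remaining column then solves Artin-Schreier equations. *)
Lemma lang_mx n e (C : 'M[k]_n) :
  (0 < e)%N -> C \in unitmx -> exists2 G, G \in unitmx & fr e G *m C = G.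
Proof.
move=> e_gt0; elim: n C => [|n IHn] C unitC.
  by exists 1%:M; rewrite ?unitmx1 // [LHS]flatmx0 [RHS]flatmx0.
rewrite -[n.+1]/(1 + n)%N in C unitC *.
pose Phi : {additive 'rV[k]_(1 + n) -> 'rV[k]_(1 + n)} := mulmxr C \o fr e.
have [||||v v0 Phi_v] :=
  @semilinear_fixed_vector k p hp e _ Phi (delta_mx 0 0) => //.
- by move=> a u; rewrite /Phi /= map_mxZ -scalemxAl.
- move=> u /(congr1 (mulmxr (invmx C))); rewrite /Phi /= mulmxK // mul0mx.
  by move/eqP; rewrite map_mx_eq0 => /eqP.
- apply/eqP => /matrixP/(_ 0 0); rewrite !mxE !eqxx => /eqP.
  by rewrite oner_eq0.
have {Phi v v0 Phi_v} [G0 unitG0 G0v] :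
    exists2 G0, G0 \in unitmx & fr e (usubmx G0) *m C = usubmx G0.
  by have [G0 unitG0 G0v] := unitmx_usubmx v0; exists G0; rewrite ?G0v.
(* If [G1] solves the equation for [C1], then [G1 *m G0] solves it for [C]. *)
pose C1 := fr e G0 *m C *m invmx G0.
have unitC1 : C1 \in unitmx.
  by rewrite !unitmx_mul unitmx_inv map_unitmx unitG0 unitC.
have def_C1 : C1 = block_mx 1%:M 0 (dlsubmx C1) (drsubmx C1).
  have upC1 : usubmx C1 = row_mx 1%:M 0.
    rewrite /C1 -!mul_usub_mx -map_usubmx G0v mul_usub_mx mulmxV //.
    by rewrite scalar_mx_block block_mxEv col_mxKu.
  by rewrite -[LHS]submxK /ulsubmx /ursubmx upC1 row_mxKl row_mxKr.
have unit_dr : drsubmx C1 \in unitmx.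
  by have := unitC1; rewrite {1}def_C1 !unitmxE det_lblock det1 mul1r.
have [G' unitG' G'C] := IHn _ unit_dr.
have [x x_fix] : exists x, x = fr e x + fr e G' *m dlsubmx C1.
  have root_i i : exists t, t = frob hp e t + (fr e G' *m dlsubmx C1) i 0.
    have [t t_fix] :=
      frob_affine_fixpoint hp 1 ((fr e G' *m dlsubmx C1) i 0) e_gt0.
    by exists t; rewrite [LHS]t_fix mulr1.
  have /fin_all_exists[t t_fix] := root_i.
  exists (\col_i t i); apply/matrixP => i j.
  by rewrite (ord1 j) !mxE [LHS]t_fix mxE.
pose G1 : 'M_(1 + n) := block_mx 1%:M 0 x G'.
have G1C1 : fr e G1 *m C1 = G1.
  rewrite def_C1 /G1 map_block_mx mulmx_block map_mx1 map_mx0.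
  by rewrite !mul1mx !mul0mx !mulmx0 mulmx1 !addr0 add0r -x_fix G'C.
exists (G1 *m G0).
  by rewrite unitmx_mul unitG0 andbT unitmxE det_lblock det1 mul1r -unitmxE.
rewrite map_mxM -[in RHS]G1C1 /C1 !mulmxA mulmxKV //.
Qed.

(** A root of [T^q = 1 - T] returns to itself after two Frobenius steps: it is an element of F_(q^2)
    of trace 1 over F_q. *)
Lemma frob_trace_one e :
  (0 < e)%N -> exists2 y : k, frob hp (e + e) y = y & y + frob hp e y = 1.
Proof.
move=> e_gt0; have [y y_fix] := frob_affine_fixpoint hp (-1) 1 e_gt0.
have yq : frob hp e y = 1 - y.
  by rewrite [in RHS]y_fix mulrN1 opprD opprK addrC subrK.
exists y; last by rewrite yq addrC subrK.
by rewrite -frob_frob yq rmorphB rmorph1 /= yq subKr.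
Qed.

(** A nonzero diagonal entry is the value at a basis vector. If the diagonal vanishes, the value at
    [e_i + c e_j] is the trace of [c H_ij], and [c] is chosen to make it 1, which works in every
    characteristic. *)
Lemma hermitian_anisotropic n e (H : 'M[k]_n) :
  (0 < e)%N -> fr e H^T = H -> H != 0 ->
  exists2 x : 'rV[k]_n, fr (e + e) x = x & (fr e x *m H *m x^T) 0 0 != 0.
Proof.
move=> e_gt0 hermH H0.
have Hsym i j : frob hp e (H i j) = H j i by rewrite -{2}hermH !mxE.
have [y y_fix y_tr] := frob_trace_one e_gt0.
have deltaH i j : (delta_mx 0 i : 'rV_n) *m H *m (delta_mx 0 j)^T = (H i j)%:M.
  rewrite trmx_delta -rowE -colE; apply/matrixP => a b.
  by rewrite !ord1 !mxE eqxx.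
have [l Hl|H_diag0] := pickP (fun l => H l l != 0).
  exists (delta_mx 0 l); first by rewrite map_delta_mx.
  by rewrite map_delta_mx deltaH mxE eqxx.
have [i [j Hij]] : exists i j, H i j != 0.
  suff /existsP[i /existsP[j Hij]] : [exists i, exists j, H i j != 0].
    by exists i, j.
  apply: contraR H0 => /existsPn H0; apply/eqP/matrixP => i j; rewrite mxE.
  by apply/eqP; have /existsPn/(_ j) := H0 i; rewrite negbK.
pose c := y / H i j.
exists (delta_mx 0 i + c *: delta_mx 0 j).
  rewrite map_mxD map_mxZ !map_delta_mx; congr (_ + _ *: _).
  by rewrite /c rmorphM fmorphV /= y_fix -frob_frob !Hsym.
rewrite map_mxD map_mxZ !map_delta_mx linearD linearZ /=.
rewrite !mulmxDl !mulmxDr -!scalemxAl -!scalemxAr !deltaH !mxE eqxx !mulr1n.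
have Hd l : H l l = 0 by move: (H_diag0 l) => /negbFE/eqP.
rewrite !Hd !mulr0 add0r addr0 -(Hsym i j) -rmorphM /c divfK //.
by rewrite y_tr oner_eq0.
Qed.

End MatrixLang.

(** * Orthonormal bases *)

Section GramIdentity.

Variables (k : closedFieldType) (p : nat) (hp : p \in [pchar k]) (e : nat).
Hypothesis e_gt0 : (0 < e)%N.

Local Notation fr e := (map_mx (frob hp e)).

(** For [B(u, v) = u^[q] A v^T], the condition on [v] says that [v] is rational for the
    F_(q^2)-structure making [B] Hermitian; it yields the symmetry for arbitrary [u]. *)
Lemma gram_swap n m m' (A : 'M[k]_n) (u : 'M_(m, n)) (v : 'M_(m', n)) :
  fr (e + e) v *m fr e A = v *m A^T ->
  fr e (fr e v *m A *m u^T)^T = fr e u *m A *m v^T.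
Proof.
move=> vA; rewrite !trmx_mul trmxK !map_mxM -!map_trmx map_frob_frob.
by rewrite -trmx_mul vA trmx_mul trmxK mulmxA.
Qed.

Lemma gram_mul m n (A Q : 'M[k]_n) (P : 'M_(m, n)) :
  fr e (P *m Q) *m A *m (P *m Q)^T = fr e P *m (fr e Q *m A *m Q^T) *m P^T.
Proof. by rewrite map_mxM trmx_mul !mulmxA. Qed.

Lemma gram_unit_vector n (A : 'M[k]_n.+1) : A \in unitmx ->
  exists2 v : 'rV[k]_n.+1,
    fr (e + e) v *m fr e A = v *m A^T & fr e v *m A *m v^T = 1%:M.
Proof.
move=> unitA.
(* With this [C], Lang's equation says that every row of [G] satisfies the condition of
   [gram_swap]. *)
have [|G unitG GC] := lang_mx hp (C := fr e A *m invmx A^T) (ltn_addl e e_gt0).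
  by rewrite unitmx_mul map_unitmx unitmx_inv unitmx_tr unitA.
have {GC} GA : fr (e + e) G *m fr e A = G *m A^T.
  by rewrite -{2}GC mulmxA mulmxKV // unitmx_tr.
pose H := fr e G *m A *m G^T.
have H0 : H != 0.
  have: H \in unitmx by rewrite !unitmx_mul map_unitmx unitmx_tr unitG unitA.
  by rewrite unitmxE unitfE; apply: contra_neq => ->; rewrite det0.
have [x x_fix] := hermitian_anisotropic e_gt0 (gram_swap G GA) H0.
pose w := x *m G; set D := _ *m _ *m x^T; pose d := D 0 0 => d0.
have wA : fr (e + e) w *m fr e A = w *m A^T.
  by rewrite map_mxM x_fix -mulmxA GA mulmxA.
have def_D : fr e w *m A *m w^T = d%:M.
  by rewrite -mx11_scalar /D /H map_mxM trmx_mul !mulmxA.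
have d_fix : frob hp e d = d.
  have := gram_swap w wA; rewrite def_D => /matrixP/(_ 0 0).
  by rewrite !mxE eqxx !mulr1n.
have [c cS] := exists_nth_root d^-1 (ltn0Sn (p ^ e)).
have {}cS : frob hp e c * c = d^-1 by rewrite -cS exprSr.
have cq0 : frob hp e c != 0.
  by apply: contraNneq d0 => cq0; rewrite -invr_eq0 -/d -cS cq0 mul0r.
(* As [c^(q+1) = 1/d] is fixed by Frobenius, [c^(q^2) c^q = c c^q], and [c^q] cancels; scaling by
   [c] thus preserves rationality. *)
have c_fix : frob hp (e + e) c = c.
  apply: (mulIf cq0); rewrite [RHS]mulrC cS -frob_frob -rmorphM cS.
  by rewrite fmorphV /= d_fix.
exists (c *: w).
  by rewrite map_mxZ /= c_fix -!scalemxAl wA.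
rewrite map_mxZ linearZ -!scalemxAl -scalemxAr def_D scalerA cS.
by rewrite scale_scalar_mx mulVf.
Qed.

(** Gram-Schmidt: a unit vector [v] is split off and induction applies to the block [A']. By
    [gram_swap] for [v], the off-diagonal blocks are [b] and its conjugate transpose, so the single
    matrix [G1] clears both. *)
Theorem gram_identity n (A : 'M[k]_n) : A \in unitmx ->
  exists2 G, G \in unitmx & fr e G *m A *m G^T = 1%:M.
Proof.
elim: n A => [|n IHn] A unitA.
  by exists 1%:M; rewrite ?unitmx1 // [LHS]flatmx0 [RHS]flatmx0.
have [v vA v1] := gram_unit_vector unitA.
rewrite -[n.+1]/(1 + n)%N in A unitA v vA v1 *.
have [G0 unitG0 G0v] :
    exists2 G0 : 'M[k]_(1 + n), G0 \in unitmx & usubmx G0 = v.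
  apply: unitmx_usubmx; apply/eqP => v0.
  move/matrixP/(_ 0 0)/eqP: v1.
  by rewrite v0 trmx0 mulmx0 !mxE eqxx eq_sym oner_eq0.
pose b := fr e v *m A *m (dsubmx G0)^T.
pose G1 : 'M_(1 + n) := block_mx 1%:M 0 (- b^T) 1%:M.
pose A' := fr e (dsubmx G0) *m A *m (dsubmx G0)^T - fr e b^T *m b.
have unitG1 : G1 \in unitmx by rewrite unitmxE det_lblock !det1 mul1r unitr1.
have gram : fr e (G1 *m G0) *m A *m (G1 *m G0)^T = block_mx 1%:M 0 0 A'.
  rewrite gram_mul.
  have -> : fr e G0 *m A *m G0^T
          = block_mx 1%:M b (fr e b^T) (A' + fr e b^T *m b).
    rewrite -[G0]vsubmxK G0v map_col_mx tr_col_mx mul_col_mx mul_col_row v1.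
    by rewrite -(gram_swap (dsubmx G0) vA) /A' subrK.
  rewrite map_block_mx tr_block_mx map_mx1 map_mx0 trmx0 !trmx1 map_mxN map_mx1.
  rewrite linearN /= trmxK !mulmx_block !(mul1mx, mulmx1, mul0mx, mulmx0, addr0, add0r).
  by rewrite !addNr mul0mx add0r mulNmx [A' + _]addrC addKr.
have unitA' : A' \in unitmx.
  have: fr e (G1 *m G0) *m A *m (G1 *m G0)^T \in unitmx.
    by rewrite !unitmx_mul map_unitmx unitmx_tr unitmx_mul unitG1 unitG0 unitA.
  by rewrite gram !unitmxE det_lblock det1 mul1r.
have [G' unitG' G'1] := IHn _ unitA'.
exists (block_mx 1%:M 0 0 G' *m (G1 *m G0)).
  rewrite !unitmx_mul unitG1 unitG0 unitmxE det_lblock det1 mul1r.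
  by rewrite -unitmxE unitG'.
rewrite gram_mul gram map_block_mx tr_block_mx !map_mx0 map_mx1 !trmx0 trmx1.
rewrite !mulmx_block.
rewrite !(mul1mx, mulmx1, mul0mx, mulmx0, addr0, add0r) G'1.
by rewrite -scalar_mx_block.
Qed.

End GramIdentity.

(** * Frobenius forms as matrices, and smoothness *)

Lemma dhomog1_linear (k : fieldType) (n : nat) (L : {mpoly k[n]}) :
  L \is 1.-homog -> L = \sum_(j < n) L@_U_(j) *: 'X_j.
Proof.
move=> homL; apply/mpolyP => m; rewrite raddf_sum /=.
under eq_bigr do rewrite mcoeffZ.
have [/mdeg1P[i /eqP ->]|m1] := boolP (mdeg m == 1)%N.
  rewrite (bigD1 i) //= mcoeffXU eqxx mulr1 big1 ?addr0 // => j ji.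
  by rewrite mcoeffXU (negPf ji) mulr0.
rewrite (dhomog_nemf_coeff homL m1) big1 // => j _; rewrite mcoeffX.
by case: eqP => [jm|]; [rewrite -jm mdeg1 in m1 | rewrite mulr0].
Qed.

Lemma frobenius_sum_matrix (k : fieldType) (p : nat) (hp : p \in [pchar k])
    (n e : nat) (F : {mpoly k[n]}) :
  (0 < e)%N -> frobenius_sum (p ^ e) F ->
  exists A : 'M[k]_n,
    (forall u : 'rV[k]_n,
       F.@[u ord0] = (map_mx (frob hp e) u *m A *m u^T) 0 0) /\
    (forall (u : 'rV[k]_n) j,
       F^`M(j).@[u ord0] = (map_mx (frob hp e) u *m A) 0 j).
Proof.
move=> e_gt0 [L homL def_F]; exists (\matrix_(i, j) (L i)@_U_(j)).
have evalL (u : 'rV[k]_n) i : (L i).@[u ord0] = \sum_j (L i)@_U_(j) * u 0 j.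
  rewrite {1}(dhomog1_linear (homL i)) raddf_sum /=.
  by apply: eq_bigr => j _; rewrite mevalZ mevalXU.
have U_subU j : (U_(j) - U_(j) = 0 :> 'X_{1..n})%MM.
  by apply/mnmP => i; rewrite mnmBE subnn mnm0E.
have dL i j : (L i)^`M(j) = ((L i)@_U_(j))%:MP.
  rewrite {1}(dhomog1_linear (homL i)) raddf_sum /= (bigD1 j) //=.
  rewrite big1 => [|l lj].
    rewrite addr0 mderivZ mderivX mnm1E eqxx U_subU mpolyX0.
    by rewrite scale1r -mul_mpolyC mulr1.
  by rewrite mderivZ mderivX mnm1E (negPf lj) scale0r scaler0.
(* The factor [p ^ e] is zero in [k], so ['X_i ^+ (p ^ e)] behaves as a constant under
   derivation. *)
have dXL i j : ('X_i ^+ (p ^ e) * L i)^`M(j) = (L i)@_U_(j) *: 'X_i ^+ (p ^ e).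
  rewrite [LHS]mderivM dL mpolyXn mderivX mulmnE natrM natrX (pcharf0 hp).
  by rewrite expr0n gtn_eqF // mulr0 scale0r mul0r add0r mulrC mul_mpolyC.
split=> u.
  rewrite def_F raddf_sum /= -mulmxA mxE.
  under eq_bigr do rewrite mevalM rmorphXn /= mevalXU evalL.
  under [RHS]eq_bigr do rewrite !mxE.
  under [RHS]eq_bigr do under eq_bigr do rewrite !mxE.
  by [].
move=> j; rewrite def_F (raddf_sum (mderiv j)) (raddf_sum (meval _)) mxE.
under [RHS]eq_bigr do rewrite !mxE.
under [LHS]eq_bigr do rewrite /= dXL mevalZ rmorphXn /= mevalXU mulrC.
by [].
Qed.

(** Coordinatewise [q]-th roots of a nonzero vector in the left kernel of [A] would give a point
    where [F] and its gradient both vanish. *)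
Lemma smooth_frobenius_unitmx (k : closedFieldType) (p : nat)
    (hp : p \in [pchar k]) (n e : nat) (F : {mpoly k[n]}) :
  (0 < e)%N -> frobenius_sum (p ^ e) F -> smooth_hypersurface F ->
  exists2 A : 'M[k]_n, A \in unitmx
    & forall u : 'rV[k]_n,
        F.@[u ord0] = (map_mx (frob hp e) u *m A *m u^T) 0 0.
Proof.
move=> e_gt0 frobF smoothF.
have [A [FA dFA]] := frobenius_sum_matrix hp e_gt0 frobF; exists A => //.
rewrite -row_free_unit -kermx_eq0.
apply/negPn/negP => /rowV0Pn[z /sub_kermxP zA z0].
have q_gt0 : (0 < p ^ e)%N by apply: ltnW; apply: (expq_gt1 hp).
have /fin_all_exists[y y_z] (i : 'I_n) := exists_nth_root (z 0 i) q_gt0.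
pose u : 'rV_n := \row_i y i.
have uz : map_mx (frob hp e) u = z.
  by apply/rowP => i; rewrite !mxE; apply: y_z.
have u0 : u != 0 by apply: contraNneq z0 => u0; rewrite -uz u0 map_mx0.
have [|i []] := smoothF u u0; first by rewrite /vanishes FA uz zA mul0mx mxE.
by rewrite /vanishes dFA uz zA mxE.
Qed.

(** * The lines of the configuration and their incidences *)

Lemma card_fset_sep_seq (T : choiceType) (P : pred T) (s : seq T) :
  uniq s -> #|` [fset x in [fset y in s]%fset | P x]%fset| = count P s.
Proof.
move=> uniq_s; rewrite -size_filter -(undup_id (filter_uniq P uniq_s)).
rewrite -card_fseq.
congr (size (enum_fset _)); apply/fsetP => x.
by rewrite !in_fset mem_filter inE /= in_fset andbC.
Qed.

Lemma meetP (k : fieldType) (l m : {vspace 'rV[k]_4}) :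
  reflect (exists2 u, u != 0 & (u \in l) && (u \in m)) (meet l m).
Proof.
apply: (iffP idP) => [lm|[u u0 /andP[ul um]]].
  by exists (vpick (l :&: m)%VS); rewrite ?vpick0 // -memv_cap memv_pick.
apply: contraNneq u0 => lm0.
by rewrite -memv0 -lm0 memv_cap ul um.
Qed.

Section Configuration.

Variables (k : fieldType) (d : nat) (w : k) (G : 'M[k]_4).
Hypotheses (wd : w ^+ d = 1) (w1 : w != 1) (unitG : G \in unitmx).
Variable R : seq k.
Hypotheses (memR : forall a, (a \in R) = (a ^+ d == -1)) (uniqR : uniq R).
Hypotheses (sizeR : size R = d) (d_gt0 : (0 < d)%N).

Definition row4 (x0 x1 x2 x3 : k) : 'rV[k]_4 :=
  \row_(i < 4) nth 0 [:: x0; x1; x2; x3] i.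

Lemma row4_inj x0 x1 x2 x3 y0 y1 y2 y3 :
  row4 x0 x1 x2 x3 = row4 y0 y1 y2 y3 ->
  [/\ x0 = y0, x1 = y1, x2 = y2 & x3 = y3].
Proof.
move=> /rowP eq_xy; have eq_at i (lt_i4 : (i < 4)%N) := eq_xy (Ordinal lt_i4).
by split; [have := eq_at 0%N isT | have := eq_at 1%N isT
         | have := eq_at 2%N isT | have := eq_at 3%N isT]; rewrite !mxE.
Qed.

Definition eps (t : bool) : k := if t then w else 1.

Lemma epsd t : eps t ^+ d = 1.
Proof. by case: t; rewrite ?expr1n. Qed.

Lemma w_neq0 : w != 0.
Proof.
apply: contra_eq_neq wd => ->.
by rewrite expr0n gtn_eqF // eq_sym oner_neq0.
Qed.

Lemma eps_neq0 t : eps t != 0.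
Proof. by case: t; rewrite ?oner_neq0 ?w_neq0. Qed.

Lemma eps_inj : injective eps.
Proof.
by case=> -[] //=; [move=> /eqP | move=> /esym/eqP]; rewrite (negPf w1).
Qed.

Lemma root_neq0 a : a \in R -> a != 0.
Proof.
rewrite memR; apply: contraTneq => ->.
by rewrite expr0n gtn_eqF // eq_sym oppr_eq0 oner_neq0.
Qed.

(* [s] selects [L] or [L'] (true for [L]), and [t] the value of [eps]. *)
Definition point (s t : bool) (a x y : k) : 'rV[k]_4 :=
  if s then row4 x y (a * x) (eps t * a * y)
  else row4 x (a * x) y (eps t * a * y).

(** Right multiplication by [G] carries Fermat coordinates to the original ones. *)
Definition fline (s t : bool) (a : k) : {vspace 'rV[k]_4} :=
  (<[point s t a 1 0 *m G]> + <[point s t a 0 1 *m G]>)%VS.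

Lemma point_comb s t a x y :
  point s t a x y = x *: point s t a 1 0 + y *: point s t a 0 1.
Proof.
apply/rowP => i; rewrite /point; case: s; rewrite !mxE;
  by case: i => -[|[|[|[|//]]]] ? /=; rewrite ?(mulr1, mulr0, addr0, add0r) // mulrC.
Qed.

Lemma flineP s t a u :
  reflect (exists x y, u = point s t a x y *m G) (u \in fline s t a).
Proof.
apply: (iffP memv_addP) => [[_ /vlineP[x ->] [_ /vlineP[y ->] ->]]|[x [y ->]]].
  by exists x, y; rewrite [in RHS]point_comb mulmxDl -!scalemxAl.
exists (x *: (point s t a 1 0 *m G)); first by rewrite memvZ ?memv_line.
exists (y *: (point s t a 0 1 *m G)); first by rewrite memvZ ?memv_line.
by rewrite [in LHS]point_comb mulmxDl -!scalemxAl.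
Qed.

Lemma point_eq0 s t a x y : (point s t a x y == 0) = (x == 0) && (y == 0).
Proof.
apply/eqP/andP => [|[/eqP-> /eqP->]]; last by rewrite point_comb !scale0r addr0.
have -> : 0 = row4 0 0 0 0.
  by apply/rowP => i; rewrite !mxE; case: i => -[|[|[|[|//]]]].
by rewrite /point; case: s => /row4_inj[-> ? ? ?]; split=> //; apply/eqP.
Qed.

Lemma point_same s t a x y t' b x' y' :
  point s t a x y = point s t' b x' y' ->
  [/\ x = x', y = y', a * x = b * x' & eps t * a * y = eps t' * b * y'].
Proof. by rewrite /point; case: s => /row4_inj[]. Qed.

Lemma point_opposite s t a x y t' b x' y' :
  point s t a x y = point (~~ s) t' b x' y' ->
  [/\ y = b * x, y' = a * x & eps t * a * y = eps t' * b * y'].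
Proof. by rewrite /point; case: s => /row4_inj[<-]. Qed.

Lemma is_line_fline s t a : is_line (fline s t a).
Proof.
rewrite /is_line /fline -[<[point s t a 0 1 *m G]>%VS]span_seq1 -span_cons.
have: free [:: point s t a 1 0 *m G; point s t a 0 1 *m G]; last first.
  by rewrite /free => /eqP->.
rewrite free_cons seq1_free span_seq1; apply/andP; split.
  apply/negP => /vlineP[c]; rewrite scalemxAl => /(can_inj (mulmxK unitG))/eqP.
  rewrite -subr_eq0 -[_ - _](_ : point s t a 1 (- c) = _) ?point_eq0 ?oner_eq0 //.
  by rewrite point_comb scale1r scaleNr.
rewrite -[X in _ != X](mul0mx 1 G) (can_eq (mulmxK unitG)).
by rewrite point_eq0 oner_eq0 andbF.
Qed.

Lemma meet_flineP s t a s' t' b :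
  reflect (exists x y x' y', point s t a x y = point s' t' b x' y'
                             /\ (x != 0) || (y != 0))
          (meet (fline s t a) (fline s' t' b)).
Proof.
apply: (iffP (meetP _ _)) => [[u u0 /andP[]]|].
  move=> /flineP[x [y u_xy]] /flineP[x' [y' u_xy']].
  exists x, y, x', y'; split.
    by apply: (can_inj (mulmxK unitG)); rewrite -u_xy.
  rewrite -negb_and -(point_eq0 s t a); apply: contraNneq u0 => p0.
  by rewrite u_xy p0 mul0mx.
case=> x [y [x' [y' [eq_p nz]]]]; exists (point s t a x y *m G).
  apply: contraL nz => /eqP/(congr1 (mulmx^~ (invmx G))).
  by rewrite mulmxK // mul0mx => /eqP; rewrite point_eq0 negb_or !negbK.
by apply/andP; split; apply/flineP; [exists x, y | exists x', y'; rewrite eq_p].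
Qed.

(** A common point has equal parameters [x], [y] on both lines; [x != 0] forces the first equation,
    [y != 0] the second. *)
Lemma meet_same_ruling s t t' a b :
  meet (fline s t a) (fline s t' b) = (a == b) || (eps t * a == eps t' * b).
Proof.
apply/meet_flineP/orP => [[x [y [x' [y' []]]]]|].
  case/point_same => <- <- ax ay /orP[x0|y0]; [left | right]; apply/eqP.
    exact: mulIf ax.
  exact: mulIf ay.
case=> /eqP eq_ab.
  exists 1, 0, 1, 0; rewrite oner_neq0; split=> //.
  by rewrite /point eq_ab; case: s; rewrite !mulr0.
exists 0, 1, 0, 1; rewrite oner_neq0 orbT; split=> //.
by rewrite /point eq_ab; case: s; rewrite !mulr0.
Qed.

(** A common point has [y = b x] and [y' = a x] with [x != 0]; comparing last coordinates leaves
    only the factors [eps]. *)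
Lemma meet_opposite_rulings s t t' a b : a != 0 -> b != 0 ->
  meet (fline s t a) (fline (~~ s) t' b) = (t == t').
Proof.
move=> a0 b0; apply/meet_flineP/eqP => [[x [y [x' [y' []]]]]|<-].
  case/point_opposite => -> ->; rewrite mulf_eq0 (negPf b0) /= orbb => eq_e x0.
  apply: eps_inj; apply: (mulIf (mulf_neq0 (mulf_neq0 a0 b0) x0)).
  by move: eq_e; rewrite !mulrA => ->; rewrite [_ * b * a]mulrAC.
exists 1, b, 1, a; rewrite oner_neq0; split=> //.
by rewrite /point; case: s; rewrite !mulr1 -!mulrA [b * a]mulrC.
Qed.

(* For [u = false] these are the lines [L(w, _)] and [L'(1, _)]; for [u = true],
   [L(1, _)] and [L'(w, _)]. *)
Definition half_double_seq (u : bool) :=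
  [seq fline s (u (+) s) a | s <- [:: true; false], a <- R].

Definition half_double (u : bool) : {fset {vspace 'rV[k]_4}} :=
  [fset l in half_double_seq u]%fset.

Lemma half_doubleP u l : l \in half_double u ->
  exists s a, a \in R /\ l = fline s (u (+) s) a.
Proof.
by rewrite in_fset /= => /allpairsP[[s a] /= [_ Ra ->]]; exists s, a.
Qed.

(** The two rulings in one half carry different [eps], so lines of different rulings are skew. Both
    the skewness and the distinctness of the lines follow from this criterion. *)
Lemma meet_half_double u s a s' b : a \in R -> b \in R ->
  meet (fline s (u (+) s) a) (fline s' (u (+) s') b) = (s == s') && (a == b).
Proof.
move=> Ra Rb; have [<-|] := eqVneq s s'.
  by rewrite meet_same_ruling (can_eq (mulKf (eps_neq0 _))) orbb.
rewrite eq_sym; case: s' s => -[] //= _.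
  by rewrite (meet_opposite_rulings false) ?root_neq0 //; case: u.
by rewrite (meet_opposite_rulings true) ?root_neq0 //; case: u.
Qed.

Lemma half_double_seq_uniq u : uniq (half_double_seq u).
Proof.
apply: allpairs_uniq => // _ _ /allpairsP[[s a] [_ Ra ->]]
  /allpairsP[[s' b] /= [_ Rb ->]] /= eq_l.
have := meet_half_double u s s' Ra Rb; rewrite /= eq_l meet_half_double //.
by rewrite !eqxx => /esym/andP[/eqP-> /eqP->].
Qed.

Lemma card_half_double u : #|` half_double u|%fset = (2 * d)%N.
Proof.
by rewrite card_fseq undup_id ?half_double_seq_uniq // size_allpairs sizeR.
Qed.

Lemma half_double_skew u : pairwise_skew (half_double u).
Proof.
move=> _ _ /half_doubleP[s [a [Ra ->]]] /half_doubleP[s' [b [Rb ->]]].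
by rewrite meet_half_double //; apply: contraNN => /andP[/eqP-> /eqP->].
Qed.

Lemma count_same_ruling t t' a : t != t' -> a \in R ->
  count (fun b => (a == b) || (eps t * a == eps t' * b)) R = 2.
Proof.
move=> tt' Ra; pose c := (eps t')^-1 * (eps t * a).
(* Besides [a], the only solution is [c], a root since [eps] takes values among [d]-th roots of
   unity; [c] differs from [a] because the two [eps] differ. *)
have Rc : c \in R.
  by rewrite memR !exprMn exprVn !epsd invr1 !mul1r -memR.
rewrite (eq_count (a2 := predU (pred1 a) (pred1 c))); last first.
  move=> b /=; rewrite eq_sym; congr (_ || _).
  by rewrite eq_sym (can2_eq (mulKf (eps_neq0 _)) (mulVKf (eps_neq0 _))).
have := count_predUI (pred1 a) (pred1 c) R.
rewrite !count_uniq_mem // Ra Rc.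
rewrite (@eq_count _ (predI _ _) pred0) ?count_pred0 ?addn0 //.
move=> b /=; apply/negbTE/negP => /andP[/eqP-> /eqP a_c]; case/negP: tt'.
apply/eqP/eps_inj/(mulIf (root_neq0 Ra)).
by rewrite [in RHS]a_c mulVKf ?eps_neq0.
Qed.

Lemma half_double_meets u :
  meets_exactly (d + 2) (half_double u) (half_double (~~ u)).
Proof.
move=> _ /half_doubleP[s [a [Ra ->]]]; set l := fline _ _ _.
rewrite [LHS](card_fset_sep_seq (meet l) (half_double_seq_uniq (~~ u))).
rewrite /half_double_seq /= cats0 count_cat !count_map /l.
(* Switching both half and ruling preserves [eps], while switching the half alone changes it. *)
have all_meet s' : s' = ~~ s ->
    count (preim (fline s' (~~ u (+) s')) (meet (fline s (u (+) s) a))) R = d.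
  move=> ->; rewrite -[RHS]sizeR -count_predT; apply: eq_in_count => b Rb /=.
  by rewrite meet_opposite_rulings ?root_neq0 //; case: (u) (s) => -[].
have two_meet : 
    count (preim (fline s (~~ u (+) s)) (meet (fline s (u (+) s) a))) R = 2.
  rewrite -[RHS](@count_same_ruling (u (+) s) (~~ u (+) s) a) //.
    by apply: eq_count => b /=; rewrite meet_same_ruling.
  by case: (u) (s) => -[].
case: s @l all_meet two_meet => l all_meet two_meet.
  by rewrite two_meet all_meet // addnC.
by rewrite two_meet all_meet.
Qed.

Lemma double_2d_half_double :
  double_2d d (half_double false) (half_double true).
Proof.
split; try exact: card_half_double; try exact: half_double_skew;
  try exact: half_double_meets.
  by move=> _ /half_doubleP[s [a [_ ->]]]; apply: is_line_fline.
by move=> _ /half_doubleP[s [a [_ ->]]]; apply: is_line_fline.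
Qed.

End Configuration.

(** * Roots of -1 and the configuration on the surface *)

Lemma roots_of_minus_one (k : closedFieldType) (p : nat) (hp : p \in [pchar k])
    (e : nat) : (0 < e)%N ->
  exists R : seq k, [/\ uniq R, size R = (p ^ e).+1
    & forall a, (a \in R) = (a ^+ (p ^ e).+1 == -1)].
Proof.
move=> e_gt0; set q := (p ^ e)%N.
have q0 : q%:R = 0 :> k by rewrite natrX (pcharf0 hp) expr0n gtn_eqF.
pose P : {poly k} := 'X^(q.+1) - (-1)%:P.
have monP : P \is monic by rewrite monicXnsubC.
have [R] := closed_field_poly_normal P; rewrite (monicP monP) scale1r => def_P.
exists R; split.
(* Since [q = 0] in [k], [P' = X^q] and [P - X P' = 1], a Bezout identity giving separability. *)
- rewrite -separable_prod_XsubC -def_P.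
  rewrite unlock; apply/Bezout_coprimepP; exists (1, - 'X).
  rewrite derivB derivC derivXn subr0 -mulr_natl -polyC_natr.
  rewrite [q.+1%:R]mulrS q0 addr0 /P mul1r mul1r mulNr /= -exprS.
  by rewrite addrC addKr polyCN opprK eqpxx.
- have := size_XnsubC (-1 : k) (ltn0Sn q).
  by rewrite -/P def_P size_prod_XsubC => -[].
by move=> a; rewrite -root_prod_XsubC -def_P rootE !hornerE subr_eq0.
Qed.

Theorem theorem6p0p2 (k : closedFieldType) (p : nat) (hp : p \in [pchar k])
    (d : nat) (F : {mpoly k[4]})
    (hF : frobenius_form p d F) (hsm : smooth_hypersurface F) :
  exists A B : {fset {vspace 'rV[k]_4}},
    [/\ double_2d d A B,
        {in A, forall l, line_on F l} &
        {in B, forall l, line_on F l}].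
Proof.
case: hF => e [e_gt0 -> frobF] {d}; set d := (p ^ e).+1.
have [A unitA FA] := smooth_frobenius_unitmx hp e_gt0 frobF hsm.
have [G unitG GA] := gram_identity hp e_gt0 unitA.
have [R [uniqR sizeR memR]] := roots_of_minus_one hp e_gt0.
rewrite -/d in sizeR memR.
have d_gt0 : (0 < d)%N by [].
(* The ratio of two distinct roots of [a^d = -1]. *)
have [w wd w1] : exists2 w : k, w ^+ d = 1 & w != 1.
  have : (1 < size R)%N by rewrite sizeR ltnS ltnW // (expq_gt1 hp).
  case: R uniqR memR {sizeR} => [|a [|b R]] //= /andP[+ _] memR _.
  rewrite inE negb_or => /andP[ab _].
  have [ad bd] : a ^+ d = -1 /\ b ^+ d = -1.
    by split; apply/eqP; rewrite -memR !inE eqxx ?orbT.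
  have b0 : b != 0.
    by apply: contra_eq_neq bd => ->; rewrite expr0n eq_sym oppr_eq0 oner_neq0.
  exists (a / b).
    by rewrite exprMn exprVn ad bd divff // oppr_eq0 oner_neq0.
  by rewrite -[1](divff b0) (inj_eq (mulIf _)) // invr_eq0.
have onF u l : l \in half_double w G R u -> line_on F l.
  case/half_doubleP=> s [a [Ra ->]] x /flineP[y [z ->]].
  have ad : a ^+ d = -1 by apply/eqP; rewrite -memR.
  have td t : eps w t ^+ d = 1 by apply: epsd.
  (* In the basis [G], [F] is the sum of the four [d]-th powers, which cancel in pairs since
     [a^d = -1] and [eps^d = 1]. *)
  rewrite /vanishes FA gram_mul GA mulmx1 mxE !big_ord_recl big_ord0 addr0.
  have frE (b : k) : frob hp e b * b = b ^+ d by rewrite /frob exprSr.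
  rewrite !mxE !frE /point; case: s; rewrite !mxE /= !exprMn td ad.
    by ring.
  by ring.
exists (half_double w G R false), (half_double w G R true).
split; [exact: double_2d_half_double | exact: onF | exact: onF].
Qed.
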